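(* Let $\{J_t\}_{t\ge0}\subset\mathbb{R}^n$ be generated by $$J_{t+1}(i)=(1-\gamma_t(i))J_t(i)+\gamma_t(i)\left((H_tJ_t)(i)+w_t(i)+u_t(i)\right),\qquad i=1,\dots,n,$$ and suppose that: (1) $\sum_{t=0}^\infty\gamma_t(i)=\infty$ and $\sum_{t=0}^\infty\gamma_t^2(i)<\infty$ for all $i$. (2) There exist a positive vector $\theta\in\mathbb{R}^n$, a vector $J^*\in\mathbb{R}^n$, and scalars $\beta\in[0,1)$ and $D\ge0$ such that $\|H_tJ-J^*\|_\theta\le\beta\|J-J^*\|_\theta+D$ for all $J\in\mathbb{R}^n$ and all $t$; moreover $H_tJ_t$ is $\mathcal{F}_t$-adapted. (3) $\mathbb{E}[w_t(i)\mid\mathcal{F}_t]=0$ and $\mathbb{E}[w_t^2(i)\mid\mathcal{F}_t]\le A_t+B_t\|J_t\|^2$ for all $i$ and $t$, where $A_t$ and $B_t$ are $\mathcal{F}_t$-adapted and bounded. (4) There exists an $\mathcal{F}_t$-adapted random sequence $\theta_t$ such that $\lim_{t\to\infty}\theta_t=0$ with probability 1 and $|u_t(i)|\le\theta_t(\|J_t\|+1)$ for all $i$ and $t$; moreover $u_t$ is $\mathcal{F}_t$-adapted. Then (1) $J_t$ is bounded with probability 1, and (2) $J_t$ converges to $J^*$ with probability 1 if $D=0$.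
   Context: $\{\mathcal{F}_t\}$ is a filtration to which $\{J_t\}$ is adapted (the history of the process up to time $t$). The stepsizes $\gamma_t(i)$ are deterministic nonnegative scalars; $H_t$ are maps $\mathbb{R}^n\to\mathbb{R}^n$ (possibly random); $w_t,u_t$ are random vectors in $\mathbb{R}^n$, with $w_t$ being $\mathcal{F}_{t+1}$-measurable. The weighted maximum norm is $\|J\|_\theta=\max_{1\le i\le n}|J(i)|/\theta(i)$, and $\|\cdot\|$ is any norm on $\mathbb{R}^n$. A random sequence is bounded if its supremum over $t$ is finite with probability 1. *)

(* Defs.v *)
From HB Require Import structures.
From mathcomp Require Import all_boot all_order all_algebra.
From mathcomp Require Import all_classical all_reals all_analysis.
From mathcomp Require Import measurable_realfun.

Set Implicit Arguments.
Unset Strict Implicit.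
Unset Printing Implicit Defensive.

Import Order.TTheory GRing.Theory Num.Theory.
Import numFieldNormedType.Exports.

Local Open Scope classical_set_scope.
Local Open Scope ring_scope.

(* Measurability for the sigma-algebra generated by G, which is G itself when
   G is a sigma-algebra. *)
Definition measurable_wrt (T : pointedType) (G : set (set T))
    (d : measure_display) (U : measurableType d) (f : T -> U) : Prop :=
  measurable_fun [set: g_sigma_algebraType G] (f : g_sigma_algebraType G -> U).

Definition is_filtration (d : measure_display) (T : measurableType d)
    (F : nat -> set (set T)) : Prop :=
  [/\ forall t, sigma_algebra [set: T] (F t),
      forall t, F t `<=` d.-measurable
    & forall s t, (s <= t)%N -> F s `<=` F t].

Definition adapted (T : pointedType) (F : nat -> set (set T)) (R : realType)
    (X : nat -> T -> R) : Prop :=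
  forall t, measurable_wrt (F t) (X t).

(* The Borel sigma-algebra of R^n is generated by the coordinates. *)
Definition adapted_vec (T : pointedType) (F : nat -> set (set T)) (R : realType)
    (n : nat) (X : nat -> T -> 'rV[R]_n) : Prop :=
  forall i : 'I_n, adapted F (fun t x => X t x 0 i).

(* Y is a version of E[X | G], for X with values in [0, +oo]. *)
Definition is_ge0_cond_exp (d : measure_display) (T : measurableType d)
    (R : realType) (P : probability T R) (G : set (set T))
    (X Y : T -> \bar R) : Prop :=
  [/\ measurable_wrt G Y, forall x, (0 <= Y x)%E
    & forall A, G A -> (\int[P]_(x in A) X x = \int[P]_(x in A) Y x)%E].

(* Y is a version of E[X | G] in the extended sense
   E[X | G] := E[X^+ | G] - E[X^- | G], which requires one of the two terms to
   be finite almost surely at each point. When X is integrable this is the usual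
   conditional expectation; no integrability of X is imposed, since a bound
   on E[X^2 | G] by an almost surely finite random variable does not give one. *)
Definition is_cond_exp (d : measure_display) (T : measurableType d)
    (R : realType) (P : probability T R) (G : set (set T))
    (X Y : T -> \bar R) : Prop :=
  [/\ measurable_fun [set: T] X, measurable_wrt G Y
    & exists Yp Yn : T -> \bar R,
      [/\ is_ge0_cond_exp P G (X^\+)%E Yp,
          is_ge0_cond_exp P G (X^\-)%E Yn,
          {ae P, forall x, (Yp x < +oo)%E \/ (Yn x < +oo)%E}
        & {ae P, forall x, Y x = (Yp x - Yn x)%E}]].

(* Only the supremum is constrained; a vector sequence is bounded when its
   norms are. *)
Definition as_bounded (d : measure_display) (T : measurableType d)
    (R : realType) (P : probability T R) (X : nat -> T -> R) : Prop :=
  {ae P, forall x, (ereal_sup (range (fun t => (X t x)%:E)) < +oo)%E}.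

Definition is_norm (R : realType) (n : nat) (N : 'rV[R]_n -> R) : Prop :=
  [/\ forall u v, N (u + v) <= N u + N v,
      forall a v, N (a *: v) = `|a| * N v
    & forall v, N v = 0 -> v = 0].

Definition wmax_norm (R : realType) (n : nat) (theta v : 'rV[R]_n) : R :=
  \big[Num.max/0]_(i < n) (`|v 0 i| / theta 0 i).

(* Main.v *)
Require Import Defs.
From HB Require Import structures.
From mathcomp Require Import all_boot all_order all_algebra.
From mathcomp Require Import all_classical all_reals all_analysis.
From mathcomp Require Import measurable_realfun ring lra.
Import Order.TTheory GRing.Theory Num.Theory.
Import numFieldNormedType.Exports.
Local Open Scope classical_set_scope.
Local Open Scope ring_scope.
Set Implicit Arguments.
Unset Strict Implicit.
Unset Printing Implicit Defensive.

(** The proof separates probability from dynamics: the randomness is used only to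
show that the noise, suitably normalised, has small tails almost surely, and the
conclusions then hold for each trajectory by a deterministic argument.

Write [y t i = (J t i - Jstar i) / theta i], let [m t >= 1] be the running
maximum of the weighted norms of [J r - Jstar], let [a t >= 1] be the running
maximum of [A] and [B], and put [q t = m t * a t]. The noise divided by [q t]
has conditional second moments bounded by a constant, because
[A t + B t * norm (J t) ^+ 2] is at most a constant times [q t ^+ 2]. So the
normalised increments [gamma t * w t / q t] have summable second moments, and
they are orthogonal to bounded past variables. A maximal inequality of
Kolmogorov type (applied to partial sums that are frozen when they reach a given
level) shows that almost surely the sums of these increments over all windows
that start late are small ([normalized_noise_tails]).

On a fixed trajectory, summation by parts bounds the true noise accumulated
since a late time [s] by a small multiple of [m t], since [a] is bounded
([relaxation_denoise]). Without that noise, [y] is averaged, with rates in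
[[0, 1]], with drifts of size at most [(beta + small) * m t + D]. Since [beta] is
less than [1], the running maximum cannot cross a level that is large compared
with [m s] and [D] ([relaxation_bounded]). If [D = 0], the same computation shows
that an eventual bound [K] on the trajectory improves to [beta * K + x] for every
positive [x], the divergence of the rates being what makes the averages forget
their past; iterating gives convergence ([relaxation_cvg0]). *)

(** * Averaging recursions *)

Lemma convex_step_le (R : realType) (g a c b K : R) :
  0 <= g -> g <= 1 -> `|a| <= K -> `|b| <= K ->
  c = (1 - g) * a + g * b -> `|c| <= K.
Proof.
move=> g0 g1 aK bK ->; apply: (le_trans (ler_normD _ _)); rewrite !normrM.
rewrite (ger0_norm g0) (@ger0_norm _ (1 - g)) ?subr_ge0//.
have := ler_wpM2l g0 bK.
have : (1 - g) * `|a| <= (1 - g) * K by apply: ler_wpM2l => //; lra.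
lra.
Qed.

(** Weights can be put into a series with small tails at the cost of a factor
twice the last weight, by summation by parts. *)
Lemma abel_sum_le (R : realType) (q d : nat -> R) (e : R) (s : nat) :
  (forall t, 0 <= q t) -> (forall t, q t <= q t.+1) -> 0 <= e ->
  (forall t, (s <= t)%N -> `|\sum_(s <= r < t) d r| <= e) ->
  forall t, (s <= t)%N -> `|\sum_(s <= r < t.+1) q r * d r| <= 2 * e * q t.
Proof.
move=> q0 qS e0 de t st.
have qmono r : q s <= q (s + r)%N.
  by elim: r => [|r ih]; rewrite ?addn0// addnS (le_trans ih).
(* Summation by parts, as an estimate on the boundary term it leaves. *)
have key : `|\sum_(s <= r < t.+1) q r * d r - q t * \sum_(s <= r < t.+1) d r|
    <= e * (q t - q s).
  rewrite -(subnKC st); elim: (t - s)%N => [|k ih].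
    by rewrite addn0 !big_nat1 !subrr normr0 mulr0.
  rewrite addnS (@big_nat_recr _ _ _ (s + k).+1) ?(@leqW s) ?leqW ?leq_addr//=.
  rewrite (@big_nat_recr _ _ _ (s + k).+1 _ d) ?leqW ?leq_addr//=.
  set N := \sum_(s <= r < (s+k).+1) q r * d r in ih *.
  set S := \sum_(s <= r < (s+k).+1) d r in ih *.
  rewrite [X in `|X|](_ : _ = (N - q (s + k)%N * S) -
    (q (s + k).+1 - q (s + k)%N) * S); last by ring.
  apply: (le_trans (ler_normB _ _)); rewrite normrM ger0_norm ?subr_ge0//.
  have Se : `|S| <= e by apply: de; rewrite leqW ?leq_addr.
  have : (q (s + k).+1 - q (s + k)%N) * `|S| <=
    (q (s + k).+1 - q (s + k)%N) * e by rewrite ler_wpM2l// subr_ge0.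
  lra.
rewrite -[X in `|X|](subrK (q t * \sum_(s <= r < t.+1) d r)).
apply: (le_trans (ler_normD _ _)); rewrite normrM (ger0_norm (q0 t)).
have := ler_wpM2l (q0 t) (de t.+1 (leqW st)).
have := mulr_ge0 e0 (q0 s).
lra.
Qed.

(** Once at most [c + delta], the sequence stays there, and while above that level
it loses at least [g t * delta] at each step, which rates with an infinite sum do
not allow for ever. *)
Lemma relaxation_eventually_le (R : realType) (g a : nat -> R) (c delta : R)
    (s : nat) :
  (forall t, (s <= t)%N -> 0 <= g t <= 1) ->
  (forall B, exists2 t, (s <= t)%N & B < \sum_(s <= r < t) g r) ->
  (forall t, (s <= t)%N -> a t.+1 <= (1 - g t) * a t + g t * c) ->
  0 < delta -> exists t0, forall t, (t0 <= t)%N -> a t <= c + delta.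
Proof.
move=> g01 gdiv ha d0.
have [[t0 [st0 at0]]|noex] := pselect (exists t0, (s <= t0)%N /\ a t0 <= c + delta).
  exists t0 => t t0t; rewrite -(subnKC t0t); elim: (t - t0)%N => [|k ih].
    by rewrite addn0.
  have sk : (s <= t0 + k)%N by rewrite (leq_trans st0)// leq_addr.
  have /andP[g0 g1] := g01 _ sk.
  rewrite addnS (le_trans (ha _ sk))//.
  have : (1 - g (t0 + k)%N) * a (t0 + k)%N <= (1 - g (t0 + k)%N) * (c + delta).
    by apply: ler_wpM2l => //; lra.
  have := mulr_ge0 g0 (ltW d0); lra.
have big t : (s <= t)%N -> c + delta < a t.
  by move=> st; rewrite ltNge; apply/negP => h; apply: noex; exists t.
have dec t : (s <= t)%N -> a t <= a s - delta * \sum_(s <= r < t) g r.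
  move=> st; rewrite -(subnKC st); elim: (t - s)%N => [|k ih].
    by rewrite addn0 big_geq// mulr0 subr0.
  have sk : (s <= s + k)%N by rewrite leq_addr.
  have /andP[g0 g1] := g01 _ sk.
  rewrite addnS big_nat_recr//= (le_trans (ha _ sk))//.
  have : g (s + k)%N * delta <= g (s + k)%N * (a (s + k)%N - c).
    by apply: ler_wpM2l => //; have := big _ sk; lra.
  lra.
have [t st] := gdiv ((a s - c) / delta); rewrite ltr_pdivrMr// => h.
have := dec _ st; have := big _ st; lra.
Qed.

(** * Trajectories of a noisy relaxation *)

Lemma near_onwards (Q : nat -> Prop) :
  (\forall t \near \oo, Q t) ->
  \forall s \near \oo, forall t, (s <= t)%N -> Q t.
Proof.
by case=> N _ NQ; exists N => // s Ns t st; apply: NQ => /=; exact: leq_trans st.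
Qed.

(** An asynchronous relaxation [y] towards the origin, as seen on one trajectory:
drift [h], vanishing error [e], and noise [q * d], where the weights [q] are
controlled by [m] and [d] has small tails. The four fields about the maximum say
all that is used of a running maximum of the absolute values of [y], whatever
positive value it starts from. *)
Record noisy_relaxation (R : realType) (n : nat) (beta D a : R)
    (g y h e d : nat -> 'I_n -> R) (m q eps : nat -> R) : Prop := {
  relax_step : forall t i,
    y t.+1 i = (1 - g t i) * y t i + g t i * (h t i + e t i) + q t * d t i;
  relax_rate_ge0 : forall t i, 0 <= g t i;
  relax_rate_le1 : \forall t \near \oo, forall i, g t i <= 1;
  relax_drift : forall t i K,
    (forall j, `|y t j| <= K) -> `|h t i| <= beta * K + D;
  relax_error : forall t i, `|e t i| <= eps t * m t;
  relax_error_cvg0 : eps t @[t --> \oo] --> 0;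
  relax_noise : forall x, 0 < x -> \forall s \near \oo,
    forall t i, (s <= t)%N -> `|\sum_(s <= r < t) d r i| <= x;
  relax_weight_ge0 : forall t, 0 <= q t;
  relax_weight_mono : forall t, q t <= q t.+1;
  relax_weight_le : forall t, q t <= a * m t;
  relax_max_ge0 : forall t, 0 <= m t;
  relax_max_mono : forall t, m t <= m t.+1;
  relax_le_max : forall t i, `|y t i| <= m t;
  relax_max_le : forall t K,
    m t <= K -> (forall i, `|y t.+1 i| <= K) -> m t.+1 <= K }.

(** Subtracting the noise accumulated since [s] turns the trajectory into one
that is averaged with the drift, the error and the subtracted noise; this last
term is small relative to the running maximum by summation by parts. *)
Lemma relaxation_denoise (R : realType) (n : nat) (beta D a : R)
    (g y h e d : nat -> 'I_n -> R) (m q eps : nat -> R) (kappa : R) :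
  noisy_relaxation beta D a g y h e d m q eps -> 0 < a -> 0 < kappa ->
  \forall s \near \oo, exists z N : nat -> 'I_n -> R,
    [/\ forall i, z s i = y s i,
        forall t i, y t i = z t i + N t i,
        forall t i, (s <= t)%N ->
          z t.+1 i = (1 - g t i) * z t i + g t i * (h t i + e t i - N t i),
        forall t i, (s <= t)%N -> `|N t.+1 i| <= kappa * m t
      & forall t i, (s <= t)%N -> `|N t i| <= kappa * m t].
Proof.
move=> Y a0 k0.
have x0 : 0 < kappa / (2 * a) by rewrite divr_gt0 ?mulr_gt0.
near=> s.
have ds : forall t i, (s <= t)%N -> `|\sum_(s <= r < t) d r i| <= kappa / (2 * a).
  by near: s; exact: (relax_noise Y).
pose N t i := \sum_(s <= r < t) q r * d r i.
have NS t i : (s <= t)%N -> `|N t.+1 i| <= kappa * m t.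
  move=> st; apply: (le_trans (@abel_sum_le _ q (d ^~ i) (kappa / (2 * a)) s
    (relax_weight_ge0 Y) (relax_weight_mono Y) (ltW x0) _ t st)).
    by move=> r sr; exact: ds.
  rewrite [leRHS](_ : _ = 2 * (kappa / (2 * a)) * (a * m t)).
    by rewrite ler_wpM2l ?(relax_weight_le Y)// mulr_ge0// ltW.
  by field; rewrite gt_eqF.
exists (fun t i => y t i - N t i), N; split => [i|t i|t i st|//|t i].
- by rewrite /N big_geq// subr0.
- by rewrite subrK.
- by rewrite (relax_step Y) /N big_nat_recr//=; ring.
- rewrite leq_eqVlt => /orP[/eqP <-|].
    by rewrite /N big_geq// normr0 mulr_ge0 ?(relax_max_ge0 Y)// ltW.
  case: t => // t; rewrite ltnS => st; apply: (le_trans (NS _ _ st)).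
  by rewrite ler_wpM2l ?(relax_max_mono Y)// ltW.
Unshelve. all: by end_near. Qed.

(** With [eta = 1 - beta], denoising with accuracy [eta / 4] leaves a net
contraction: if the maximum is at most [M] then the drift is at most
[(1 - eta / 2) * M + D], which is at most [(1 - eta / 4) * M] for large [M], and
restoring the noise gives at most [M] again. *)
Lemma relaxation_bounded (R : realType) (n : nat) (beta D a : R)
    (g y h e d : nat -> 'I_n -> R) (m q eps : nat -> R) :
  noisy_relaxation beta D a g y h e d m q eps ->
  0 <= beta -> beta < 1 -> 0 <= D -> 0 < a -> exists M, forall t, m t <= M.
Proof.
move=> Y b0 b1 D0 a0; pose eta := 1 - beta.
have eta0 : 0 < eta / 4 by rewrite /eta; lra.
near \oo => s.
have g1 t i : (s <= t)%N -> g t i <= 1.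
  by move=> st; move: t st i; near: s; apply: near_onwards; exact: relax_rate_le1 Y.
have eps1 t : (s <= t)%N -> eps t <= eta / 4.
  move: t; near: s; apply: near_onwards.
  have /cvgrPdist_le/(_ _ eta0) := relax_error_cvg0 Y.
  by apply: filterS => t; rewrite sub0r normrN; apply: le_trans; exact: ler_norm.
have [z [N [zs yE zS NS Nle]]] : exists z N : nat -> 'I_n -> R,
    [/\ forall i, z s i = y s i,
        forall t i, y t i = z t i + N t i,
        forall t i, (s <= t)%N ->
          z t.+1 i = (1 - g t i) * z t i + g t i * (h t i + e t i - N t i),
        forall t i, (s <= t)%N -> `|N t.+1 i| <= (eta / 4) * m t
      & forall t i, (s <= t)%N -> `|N t i| <= (eta / 4) * m t].
  by near: s; exact: (relaxation_denoise Y).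
(* The two terms make [m s <= 3 / 4 * M] and [D <= eta / 4 * M]. *)
pose M := 4 * m s / 3 + 4 * D / eta.
have ms0 := relax_max_ge0 Y s.
have De : 0 <= D / eta by rewrite divr_ge0// /eta; lra.
have DM : D <= eta / 4 * M.
  rewrite /M [leLHS](_ : _ = eta * (D / eta)); last first.
    by field; rewrite gt_eqF// /eta; lra.
  have : 0 <= eta * m s by rewrite mulr_ge0// /eta; lra.
  lra.
have sM : m s <= 3 / 4 * M by rewrite /M; lra.
have M0 : 0 <= M by lra.
have ms_le t : (t <= s)%N -> m t <= m s.
  move=> ts; rewrite -(subnKC ts); elim: (s - t)%N => [|k ih]; rewrite ?addn0//.
  by rewrite addnS (le_trans ih) ?(relax_max_mono Y).
have etaM : 0 <= beta * M by rewrite mulr_ge0.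
have key k : m (s + k)%N <= M /\ forall i, `|z (s + k)%N i| <= (1 - eta / 4) * M.
  elim: k => [|k [mM zM]].
    rewrite addn0; split => [|i]; first by lra.
    by rewrite zs (le_trans (relax_le_max Y s i))// (le_trans sM)// /eta; lra.
  have sk : (s <= s + k)%N := leq_addr k s.
  rewrite addnS; set t := (s + k)%N in mM zM sk *.
  have zM' i : `|z t.+1 i| <= (1 - eta / 4) * M.
    apply: (convex_step_le (relax_rate_ge0 Y t i) (g1 t i sk) (zM i) _ (zS t i sk)).
    apply: (le_trans (ler_normB _ _)); apply: (le_trans (lerD (ler_normD _ _) (lexx _))).
    have h1 := relax_drift Y i (relax_le_max Y t).
    have h2 := relax_error Y t i.
    have h3 := Nle t i sk.
    have h4 : eps t * m t <= eta / 4 * m t.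
      by rewrite ler_wpM2r ?(relax_max_ge0 Y) ?eps1.
    have h5 : (beta + eta / 4 + eta / 4) * m t <= (beta + eta / 4 + eta / 4) * M.
      by rewrite ler_wpM2l// /eta; lra.
    rewrite /eta in DM h2 h3 h4 h5 *; lra.
  split => //; apply: (relax_max_le Y mM) => i.
  rewrite yE (le_trans (ler_normD _ _))//.
  have h1 := NS t i sk; have := zM' i.
  have : eta / 4 * m t <= eta / 4 * M by rewrite ler_wpM2l// ltW.
  lra.
exists M => t; case: (leqP s t) => [st|/ltnW ts].
  by rewrite -(subnKC st); case: (key (t - s)%N).
by rewrite (le_trans (ms_le _ ts))//; lra.
Unshelve. all: by end_near. Qed.

(** The bound improves from [K] to [beta * K + x]: after denoising, all the
trajectory is averaged with has absolute value at most [beta * K + x / 2], and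
averages whose rates sum to infinity approach that level. *)
Lemma relaxation_contract (R : realType) (n : nat) (beta a M K x : R)
    (g y h e d : nat -> 'I_n -> R) (m q eps : nat -> R) :
  noisy_relaxation beta 0 a g y h e d m q eps -> 0 < a ->
  (forall i s B, exists2 t, (s <= t)%N & B < \sum_(s <= r < t) g r i) ->
  (forall t, m t <= M) -> 0 < x ->
  (\forall t \near \oo, forall i, `|y t i| <= K) ->
  \forall t \near \oo, forall i, `|y t i| <= beta * K + x.
Proof.
move=> Y a0 gdiv mM x0 yK.
have M0 : 0 <= M := le_trans (relax_max_ge0 Y 0%N) (mM 0%N).
pose kappa := x / 4 / (M + 1).
have M1 : 0 < M + 1 by lra.
have k0 : 0 < kappa by rewrite !divr_gt0.
have small c t : c <= kappa -> c * m t <= x / 4.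
  move=> ck; apply: (@le_trans _ _ (kappa * (M + 1))); last first.
    by rewrite divfK// gt_eqF.
  apply: (@le_trans _ _ (kappa * m t)).
    by rewrite ler_wpM2r// (relax_max_ge0 Y).
  by rewrite ler_wpM2l ?(ltW k0)//; have := mM t; lra.
near \oo => s.
have g1 t i : (s <= t)%N -> g t i <= 1.
  by move=> st; move: t st i; near: s; apply: near_onwards; exact: relax_rate_le1 Y.
have eps1 t : (s <= t)%N -> eps t <= kappa.
  move: t; near: s; apply: near_onwards.
  have /cvgrPdist_le/(_ _ k0) := relax_error_cvg0 Y.
  by apply: filterS => t; rewrite sub0r normrN; apply: le_trans; exact: ler_norm.
have ysK t : (s <= t)%N -> forall i, `|y t i| <= K.
  by move: t; near: s; apply: near_onwards.
have [z [N [_ yE zS _ Nle]]] : exists z N : nat -> 'I_n -> R,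
    [/\ forall i, z s i = y s i,
        forall t i, y t i = z t i + N t i,
        forall t i, (s <= t)%N ->
          z t.+1 i = (1 - g t i) * z t i + g t i * (h t i + e t i - N t i),
        forall t i, (s <= t)%N -> `|N t.+1 i| <= kappa * m t
      & forall t i, (s <= t)%N -> `|N t i| <= kappa * m t].
  by near: s; exact: (relaxation_denoise Y).
have Nx t i : (s <= t)%N -> `|N t i| <= x / 4.
  by move=> st; rewrite (le_trans (Nle _ _ st))// small.
have zle i : exists t0, forall t, (t0 <= t)%N ->
    `|z t i| <= beta * K + x / 2 + x / 4.
  apply: (@relaxation_eventually_le _ (g ^~ i) (fun t => `|z t i|) _ _ s).
  - by move=> t st; rewrite (relax_rate_ge0 Y) g1.
  - by move=> B; exact: gdiv.
  - move=> t st; rewrite zS//; apply: (le_trans (ler_normD _ _)); rewrite !normrM.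
    have g0 := relax_rate_ge0 Y t i; have g1' := g1 t i st.
    rewrite (ger0_norm g0) (@ger0_norm _ (1 - g t i)) ?subr_ge0//.
    rewrite lerD2l ler_wpM2l//.
    apply: (le_trans (ler_normB _ _)).
    apply: (le_trans (lerD (ler_normD _ _) (lexx _))).
    have := relax_drift Y i (ysK _ st); have := relax_error Y t i.
    have := small _ t (eps1 _ st); have := Nx t i st; lra.
  - by lra.
have zle' : \forall t \near \oo, forall i, `|z t i| <= beta * K + x / 2 + x / 4.
  by apply: filter_forall => i; have [t0 zt0] := zle i; exists t0.
near=> t => i.
have st : (s <= t)%N by near: t; exact: nbhs_infty_ge.
rewrite yE (le_trans (ler_normD _ _))//.
have : `|z t i| <= beta * K + x / 2 + x / 4 by move: i; near: t.
have := Nx t i st; lra.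
Unshelve. all: by end_near. Qed.

Lemma relaxation_cvg0 (R : realType) (n : nat) (beta a : R)
    (g y h e d : nat -> 'I_n -> R) (m q eps : nat -> R) :
  noisy_relaxation beta 0 a g y h e d m q eps ->
  0 <= beta -> beta < 1 -> 0 < a ->
  (forall i s B, exists2 t, (s <= t)%N & B < \sum_(s <= r < t) g r i) ->
  forall x, 0 < x -> \forall t \near \oo, forall i, `|y t i| <= x.
Proof.
move=> Y b0 b1 a0 gdiv x x0.
have [M mM] := relaxation_bounded Y b0 b1 (lexx 0) a0.
pose c := x / 2.
(* The level [c] is the fixed point of [K |-> beta * K + c * (1 - beta)]. *)
have step k : \forall t \near \oo, forall i, `|y t i| <= beta ^+ k * M + c.
  elim: k => [|k ih].
    near=> t => i; rewrite expr0 mul1r (le_trans (relax_le_max Y t i))//.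
    by have := mM t; rewrite /c; lra.
  have := @relaxation_contract _ _ _ _ _ _ (c * (1 - beta)) _ _ _ _ _ _ _ _
    Y a0 gdiv mM _ ih.
  rewrite mulr_gt0 ?subr_gt0 ?divr_gt0// => /(_ isT).
  apply: filterS => t yt i; apply: (le_trans (yt i)).
  by rewrite exprS -mulrA; lra.
have : beta ^+ k * M @[k --> \oo] --> 0.
  rewrite -[X in _ --> X](mul0r M); apply: cvgMl.
  by apply: cvg_expr; rewrite ger0_norm.
move=> /cvgrPdist_le/(_ c); rewrite divr_gt0// => /(_ isT) [k _ /(_ k (leqnn k))].
rewrite sub0r normrN => /(le_trans (ler_norm _)) bk.
apply: filterS (step k) => t yt i; apply: (le_trans (yt i)).
by rewrite /c in bk *; lra.
Unshelve. all: by end_near. Qed.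

(** * Testing conditional expectations *)

Lemma measurable_wrt_sub (T : pointedType) (G G' : set (set T))
    (d : measure_display) (U : measurableType d) (f : T -> U) :
  G `<=` G' -> measurable_wrt G f -> measurable_wrt G' f.
Proof.
move=> GG' mf _ B mB; apply: (@sub_sigma_algebra2 _ setT _ _ GG').
exact: mf.
Qed.

Lemma measurable_wrt_measurable (d d' : measure_display) (T : measurableType d)
    (U : measurableType d') (G : set (set T)) (f : T -> U) :
  G `<=` d.-measurable -> measurable_wrt G f -> measurable_fun [set: T] f.
Proof.
move=> GT mf _ B mB.
have : <<s d.-measurable >> ([set: T] `&` f @^-1` B).
  by apply: (@sub_sigma_algebra2 _ setT _ _ GT); exact: mf.
by rewrite sigma_algebra_id//; exact: sigma_algebra_measurable.
Qed.

Import HBNNSimple.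

(** The map [p] lets the simple function live on another measurable space than
the integrand, here the same set with a smaller sigma-algebra. *)
Lemma integral_nnsfun_mul (d d' : measure_display) (T : measurableType d)
    (S : measurableType d') (R : realType) (mu : {measure set T -> \bar R})
    (p : T -> S) (s : {nnsfun S >-> R}) (X : T -> \bar R) :
  measurable_fun setT p -> measurable_fun setT X -> (forall x, 0 <= X x)%E ->
  (\int[mu]_x ((s (p x))%:E * X x) =
   \sum_(y \in range s) (y%:E * \int[mu]_(x in p @^-1` (s @^-1` [set y])) X x))%E.
Proof.
move=> mp mX X0.
under eq_integral => x _.
  rewrite fimfunE -fsumEFin// ge0_mule_fsuml; last first.
    by move=> y; rewrite EFinM; exact: nnfun_muleindic_ge0.
  over.
have mA y : measurable (p @^-1` (s @^-1` [set y])).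
  by rewrite -[X in measurable X]setTI; apply: mp => //; exact: measurable_sfunP.
have mI y : measurable_fun setT (fun x => (\1_(s @^-1` [set y]) (p x))%:E * X x)%E.
  apply: emeasurable_funM => //; apply/measurable_EFinP.
  by apply: measurableT_comp => //; exact: measurable_indic.
rewrite ge0_integral_fsum//; last 2 first.
- move=> y; under eq_fun do rewrite EFinM -muleA.
  exact: measurable_funeM.
- move=> y x _; apply: mule_ge0 => //.
  by rewrite EFinM; exact: nnfun_muleindic_ge0.
apply: eq_fsbigr => y; rewrite inE => -[x _ <-].
under eq_integral do rewrite EFinM -muleA.
rewrite ge0_integralZl_EFin//; last first.
  by move=> z _; rewrite mule_ge0// lee_fin.
congr (_ * _)%E; rewrite [RHS]integral_mkcond epatch_indic.
by apply: eq_integral => z _ /=; rewrite muleC.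
Qed.

(** Conditional expectations are characterised by integrals over events; by
linearity and monotone convergence they can be tested against every
nonnegative function that is measurable for the conditioning. *)
Lemma cond_exp_pull_out (d : measure_display) (T : measurableType d)
    (R : realType) (P : probability T R) (G : set (set T))
    (X Y : T -> \bar R) (g : T -> R) :
  sigma_algebra setT G -> G `<=` d.-measurable ->
  measurable_fun setT X -> (forall x, 0 <= X x)%E -> is_ge0_cond_exp P G X Y ->
  measurable_wrt G g -> (forall x, 0 <= g x) ->
  (\int[P]_x ((g x)%:E * X x) = \int[P]_x ((g x)%:E * Y x))%E.
Proof.
move=> sG GT mX X0 [mY Y0 XY] mg g0.
have mYT := measurable_wrt_measurable GT mY.
have mG : measurable_fun [set: g_sigma_algebraType G]
    (EFin \o (g : g_sigma_algebraType G -> R)).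
  exact/measurable_EFinP.
have mid : measurable_fun [set: T] (id : T -> g_sigma_algebraType G).
  by apply: (measurable_wrt_measurable GT); exact: measurable_id.
pose s := nnsfun_approx measurableT mG.
have s_cvg x : (s n x)%:E @[n --> \oo] --> (g x)%:E.
  by apply: (cvg_nnsfun_approx measurableT mG) => // z _; rewrite /= lee_fin.
have step (Z : T -> \bar R) : measurable_fun setT Z -> (forall x, 0 <= Z x)%E ->
    (\int[P]_x ((s n x)%:E * Z x) @[n --> \oo] --> \int[P]_x ((g x)%:E * Z x))%E.
  move=> mZ Z0.
  rewrite [X in _ --> X](_ : _ = \int[P]_x limn (fun n => (s n x)%:E * Z x))%E.
    apply: cvg_monotone_convergence => //.
    - move=> n; apply: emeasurable_funM => //; apply/measurable_EFinP.
      exact: (measurableT_comp (measurable_funPT (s n)) mid).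
    - by move=> n x _; rewrite mule_ge0// lee_fin.
    - move=> x _ m n mn; apply: lee_wpmul2r => //; rewrite lee_fin.
      by have /lefP := nd_nnsfun_approx measurableT mG mn; exact.
  apply: eq_integral => x _; apply/esym/cvg_lim => //.
  (* Where [g] vanishes, so do its approximations: [Z x] may be infinite. *)
  have [gx0|gx0] := eqVneq (g x) 0.
    have s0 n : s n x = 0.
      apply/eqP; rewrite eq_le fun_ge0 andbT -lee_fin -gx0.
      rewrite -(cvg_lim _ (s_cvg x))//; apply: lime_ge.
        by apply/cvg_ex; exists (g x)%:E; exact: s_cvg.
      near=> m; rewrite lee_fin.
      have nm : (n <= m)%N by near: m; exact: nbhs_infty_ge.
      by have /lefP := nd_nnsfun_approx measurableT mG nm; exact.
    by under eq_cvg do rewrite s0; rewrite gx0; exact: cvg_cst.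
  apply: cvgeM; [|exact: s_cvg|exact: cvg_cst].
  by rewrite /mule_def gx0; case: (Z x).
have eqn n : (\int[P]_x ((s n x)%:E * X x) = \int[P]_x ((s n x)%:E * Y x))%E.
  rewrite (integral_nnsfun_mul _ (s n) mid)// (integral_nnsfun_mul _ (s n) mid)//.
  apply: eq_fsbigr => y _; congr (_ * _)%E; apply: XY.
  rewrite -[X in X _](sigma_algebra_id sG).
  exact: (measurable_sfunP (s n)).
have := step _ mX X0; under eq_cvg do rewrite eqn.
by move=> /cvg_unique; apply; [exact: ereal_hausdorff|exact: step].
Unshelve. all: by end_near. Qed.

(** As [+oo - +oo] is [-oo], a vanishing difference forces both parts to be
finite. *)
Lemma cond_exp0_parts_eq (d : measure_display) (T : measurableType d)
    (R : realType) (P : probability T R) (Yp Yn : T -> \bar R) :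
  (forall x, 0 <= Yp x)%E -> (forall x, 0 <= Yn x)%E ->
  {ae P, forall x, (Yp x < +oo)%E \/ (Yn x < +oo)%E} ->
  {ae P, forall x, 0%E = (Yp x - Yn x)%E} -> {ae P, forall x, Yp x = Yn x}.
Proof.
move=> p0 n0; apply: filterS2 => x.
case: (Yp x) (p0 x) => [p| |]//; case: (Yn x) (n0 x) => [q| |]// _ _.
by move=> _ -[/eqP]; rewrite eq_sym subr_eq0 => /eqP ->.
Qed.

Lemma pos_partM (R : realDomainType) (z w : R) :
  Num.max (z * w) 0 =
  Num.max z 0 * Num.max w 0 + Num.max (- z) 0 * Num.max (- w) 0.
Proof.
case: (lerP z 0) => z0; case: (lerP w 0) => w0.
- rewrite !max_l ?oppr_ge0 ?mulr_le0//; ring.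
- rewrite (@max_r _ _ (z * w)) ?(max_r (_ : - w <= 0)) ?mulr_le0_ge0// ?(ltW w0)//.
  by ring.
  by rewrite oppr_le0 ltW.
- rewrite (@max_r _ _ (z * w)) ?(max_r (_ : - z <= 0)) ?mulr_ge0_le0// ?(ltW z0)//.
  by ring.
  by rewrite oppr_le0 ltW.
- rewrite max_l ?mulr_ge0 ?ltW//.
  by rewrite (@max_r _ _ (- z)) ?oppr_le0 ?ltW// mul0r addr0.
Qed.

(** A centred noise is orthogonal to every past variable as soon as the product
is integrable. The noise itself need not be, so the positive and negative parts
are conditioned separately. *)
Lemma cond_exp0_orthogonal (d : measure_display) (T : measurableType d)
    (R : realType) (P : probability T R) (G : set (set T)) (w Z : T -> R) :
  sigma_algebra setT G -> G `<=` d.-measurable ->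
  is_cond_exp P G (EFin \o w) (fun=> 0%E) -> measurable_wrt G Z ->
  P.-integrable setT (EFin \o (fun x => Z x * w x)) ->
  (\int[P]_x (Z x * w x)%:E = 0)%E.
Proof.
move=> sG GT [mw _ [Yp [Yn [hp hn fin Y0]]]] mZ intZw.
have [mYp Yp0 _] := hp; have [mYn Yn0 _] := hn.
have mYpT := measurable_wrt_measurable GT mYp.
have mYnT := measurable_wrt_measurable GT mYn.
have Ypn := cond_exp0_parts_eq Yp0 Yn0 fin Y0.
pose Zp x := Num.max (Z x) 0; pose Zn x := Num.max (- Z x) 0.
have mZp : measurable_wrt G Zp.
  by apply: measurable_funrpos.
have mZn : measurable_wrt G Zn.
  by apply: measurable_funrneg.
have Zp0 x : 0 <= Zp x by rewrite le_max lexx orbT.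
have Zn0 x : 0 <= Zn x by rewrite le_max lexx orbT.
have mwp := measurable_funepos mw; have mwn := measurable_funeneg mw.
have mZpT := measurable_wrt_measurable GT mZp.
have mZnT := measurable_wrt_measurable GT mZn.
have mM (z : T -> R) (f : T -> \bar R) : measurable_fun setT z ->
    measurable_fun setT f -> measurable_fun setT (fun x => (z x)%:E * f x)%E.
  by move=> mz mf; apply: emeasurable_funM => //; exact/measurable_EFinP.
have swap (z : T -> R) : measurable_wrt G z -> (forall x, 0 <= z x) ->
    (\int[P]_x ((z x)%:E * (EFin \o w)^\+ x) =
     \int[P]_x ((z x)%:E * (EFin \o w)^\- x))%E.
  move=> mz z0; rewrite (cond_exp_pull_out sG GT mwp _ hp)//.
  rewrite (cond_exp_pull_out sG GT mwn _ hn)//.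
  have mzT := measurable_wrt_measurable GT mz.
  apply: ge0_ae_eq_integral => //; [exact: mM|exact: mM|..].
  - by move=> x _; rewrite mule_ge0// lee_fin.
  - by move=> x _; rewrite mule_ge0// lee_fin.
  - by move: Ypn; apply: filterS => x -> _.
have posE : (\int[P]_x (EFin \o (fun x => Z x * w x)%R)^\+ x =
    \int[P]_x ((Zp x)%:E * (EFin \o w)^\+ x) +
    \int[P]_x ((Zn x)%:E * (EFin \o w)^\- x))%E.
  rewrite -ge0_integralD//; last 4 first.
  - by move=> x _; rewrite mule_ge0// lee_fin.
  - exact: mM.
  - by move=> x _; rewrite mule_ge0// lee_fin.
  - exact: mM.
  apply: eq_integral => x _; rewrite !funeposE funenegE /= /Zp /Zn.
  by rewrite -!EFin_max -!EFinM -EFinD pos_partM.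
have negE : (\int[P]_x (EFin \o (fun x => Z x * w x)%R)^\- x =
    \int[P]_x ((Zp x)%:E * (EFin \o w)^\- x) +
    \int[P]_x ((Zn x)%:E * (EFin \o w)^\+ x))%E.
  rewrite -ge0_integralD//; last 4 first.
  - by move=> x _; rewrite mule_ge0// lee_fin.
  - exact: mM.
  - by move=> x _; rewrite mule_ge0// lee_fin.
  - exact: mM.
  apply: eq_integral => x _; rewrite !funenegE funeposE /= /Zp /Zn.
  by rewrite -!EFin_max -!EFinM -EFinD -mulrN pos_partM opprK.
rewrite integralE posE negE (swap _ mZp Zp0) (swap _ mZn Zn0) subee//.
rewrite -(swap _ mZn Zn0) -negE.
exact: integrable_neg_fin_num.
Qed.

(** For nonnegative [X] the conditional expectation of the negative part
vanishes, so a bound on a version of [E[X | G]] bounds the conditional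
expectation of the positive part, which may be tested against [g]. *)
Lemma cond_exp_weighted_le (d : measure_display) (T : measurableType d)
    (R : realType) (P : probability T R) (G : set (set T)) (X g v : T -> R)
    (V : T -> \bar R) (c : R) :
  sigma_algebra setT G -> G `<=` d.-measurable ->
  (forall x, 0 <= X x) -> is_cond_exp P G (EFin \o X) V ->
  {ae P, forall x, (V x <= (v x)%:E)%E} -> measurable_wrt G g ->
  0 <= c -> (forall x, 0 <= g x) -> (forall x, g x * v x <= c) ->
  (\int[P]_x (g x * X x)%:E <= c%:E)%E.
Proof.
move=> sG GT X0 [mX mV [Yp [Yn [hp hn _ VY]]]] Vv mg c0 g0 gvc.
have [mYp Yp0 _] := hp; have [mYn Yn0 hYn] := hn.
have mYpT := measurable_wrt_measurable GT mYp.
have mYnT := measurable_wrt_measurable GT mYn.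
have mgT := measurable_wrt_measurable GT mg.
have XpE : (EFin \o X)^\+%E = (EFin \o X).
  by apply/funext => x; rewrite funeposE/= max_l// lee_fin.
have XnE : (EFin \o X)^\-%E = cst 0%E.
  by apply/funext => x; rewrite funenegE/= max_r// lee_fin oppr_le0.
have Yn_ae : {ae P, forall x, Yn x = 0%E}.
  have GT0 : G setT by have [s0 sC _] := sG; rewrite -(setD0 setT); exact: sC.
  have := hYn _ GT0; rewrite XnE integral0 => /esym intYn.
  have /(ae_eq_integral_abs P measurableT mYnT) : (\int[P]_x `|Yn x| = 0)%E.
    by rewrite -[RHS]intYn; apply: eq_integral => x _; rewrite gee0_abs.
  by apply: filterS => x /(_ I).
have YpV : {ae P, forall x, Yp x <= (v x)%:E}%E.
  move: Yn_ae VY Vv; by apply: filterS3 => x -> ->; rewrite sube0.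
rewrite [leLHS](_ : _ = \int[P]_x ((g x)%:E * Yp x))%E; last first.
  rewrite -(cond_exp_pull_out sG GT _ _ hp)//; last first.
    by rewrite XpE.
  by apply: eq_integral => x _; rewrite XpE/= EFinM.
rewrite -[leRHS]mule1 -(@probability_setT _ _ _ P) -integral_cst//.
apply: ae_ge0_le_integral => //.
- by move=> x _; rewrite mule_ge0 ?lee_fin.
- by apply: emeasurable_funM => //; exact/measurable_EFinP.
move: YpV; apply: filterS => x Yv _; apply: (@le_trans _ _ ((g x)%:E * (v x)%:E)%E).
  by rewrite lee_wpmul2l// lee_fin.
by rewrite -EFinM lee_fin.
Qed.

(** * Series of orthogonal increments *)

(** Freezing the partial sums that start at [s] once they reach [eps] lets a
single late value record every earlier excursion, so that Chebyshev's inequality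
for one variable controls a whole window. *)
Fixpoint frozen_sum (R : realType) (eps : R) (d : nat -> R) (s k : nat) : R :=
  if k is k'.+1 then
    frozen_sum eps d s k' +
      (if `|frozen_sum eps d s k'| < eps then d (s + k')%N else 0)
  else 0.

Lemma frozen_sum_mono (R : realType) (eps : R) (d : nat -> R) (s k l : nat) :
  (k <= l)%N -> eps <= `|frozen_sum eps d s k| ->
  eps <= `|frozen_sum eps d s l|.
Proof.
move=> kl ek; rewrite -(subnKC kl); elim: (l - k)%N => [|j ih].
  by rewrite addn0.
by rewrite addnS/= ltNge ih/= addr0.
Qed.

(** This turns a bound on one frozen sum at the end of a window into a bound on
all partial sums in the window. *)
Lemma frozen_sumP (R : realType) (eps : R) (d : nat -> R) (s t : nat) :
  (s <= t)%N -> eps <= `|\sum_(s <= r < t) d r| ->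
  eps <= `|frozen_sum eps d s (t - s)|.
Proof.
move=> st.
have [//|->//] : eps <= `|frozen_sum eps d s (t - s)| \/
    frozen_sum eps d s (t - s) = \sum_(s <= r < t) d r.
rewrite -[in X in _ \/ _ = X](subnKC st); elim: (t - s)%N => [|k ih].
  by right; rewrite addn0 big_geq.
have [ek|ek] := leP eps `|frozen_sum eps d s k|.
  by left; apply: (@frozen_sum_mono _ _ _ _ k).
right; rewrite /= ek addnS big_nat_recr ?leq_addr//=.
by case: ih => [|->//]; rewrite leNgt ek.
Qed.

Section orthogonal_increments.
Context (d : measure_display) (T : measurableType d) (R : realType)
  (P : probability T R) (F : nat -> set (set T)) (D : nat -> T -> R)
  (c : nat -> R).
Context (FF : is_filtration F) (mD : forall t, measurable_wrt (F t.+1) (D t))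
  (D2 : forall t, (\int[P]_x (D t x ^+ 2)%:E <= (c t)%:E)%E)
  (Dorth : forall t (Z : T -> R) (M : R), measurable_wrt (F t) Z ->
     (forall x, `|Z x| <= M) ->
     P.-integrable setT (EFin \o (fun x => Z x * D t x)) ->
     (\int[P]_x (Z x * D t x)%:E = 0)%E).

Let S eps s k x := frozen_sum eps (D ^~ x) s k.

Lemma measurable_frozen_sum eps s k : measurable_wrt (F (s + k)%N) (S eps s k).
Proof.
have [_ _ Fmono] := FF.
elim: k => [|k ih]; first exact: measurable_cst.
have ih' : measurable_wrt (F (s + k.+1)%N) (S eps s k).
  by apply: measurable_wrt_sub ih; apply: Fmono; rewrite addnS.
apply: measurable_funD => //; apply: measurable_fun_ifT => //.
- apply: measurable_fun_ltr => //; exact: measurableT_comp.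
- by rewrite addnS; exact: mD.
Qed.

Lemma measurable_frozen_level eps s k :
  measurable [set x | eps <= `|S eps s k x|].
Proof.
have [_ FT _] := FF.
rewrite -[X in measurable X]setTI; apply: measurable_fun_ler => //.
apply: measurableT_comp => //.
exact: (measurable_wrt_measurable (FT _) (@measurable_frozen_sum eps s k)).
Qed.

(** Freezing multiplies each increment by a bounded past variable, so the
increments stay orthogonal and second moments still add up. *)
Lemma frozen_sum_moment eps s k :
  P.-integrable setT (EFin \o (fun x => S eps s k x ^+ 2)) /\
  (\int[P]_x (S eps s k x ^+ 2)%:E <= (\sum_(s <= r < s + k) c r)%:E)%E.
Proof.
have [_ FT _] := FF.
have mDT t : measurable_fun setT (D t) := measurable_wrt_measurable (FT _) (@mD t).
have mD2 t : measurable_fun setT (EFin \o (fun x => D t x ^+ 2)).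
  by apply/measurable_EFinP; exact: measurable_funX.
have iD2 t : P.-integrable setT (EFin \o (fun x => D t x ^+ 2)).
  apply/integrableP; split => //.
  apply: (@le_lt_trans _ _ (c t)%:E); last by rewrite ltry.
  apply: le_trans (D2 t); rewrite le_eqVlt; apply/orP; left; apply/eqP.
  by apply: eq_integral => x _ /=; rewrite ger0_norm// sqr_ge0.
elim: k => [|k [iS SC]].
  rewrite addn0 big_geq//=; split.
    by rewrite (_ : _ \o _ = cst 0%E) ?integrable0//; apply/funext => x /=;
      rewrite expr0n.
  by rewrite integral0_eq// => x _; rewrite expr0n.
set t := (s + k)%N.
pose Z x := if `|S eps s k x| < eps then S eps s k x else 0.
have mS := @measurable_frozen_sum eps s k.
have mZ : measurable_wrt (F t) Z.
  apply: measurable_fun_ifT => //.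
  by apply: measurable_fun_ltr => //; exact: measurableT_comp.
have Zle x : `|Z x| <= `|eps|.
  rewrite /Z; case: ifPn => [/ltW/le_trans|]; last by rewrite normr0.
  by apply; exact: ler_norm.
have mZD : measurable_fun setT (fun x => Z x * D t x).
  by apply: measurable_funM => //; exact: (measurable_wrt_measurable (FT _) mZ).
(* [|Z * D| <= |eps| * (1 + D ^+ 2)], the square being integrable. *)
have iZD : P.-integrable setT (EFin \o (fun x => Z x * D t x)).
  apply: (@le_integrable _ _ _ _ _ measurableT _
    (fun x => (`|eps|)%:E * (1 + D t x ^+ 2)%:E)%E).
  - exact/measurable_EFinP.
  - move=> x _ /=.
    have D10 : 0 <= 1 + D t x ^+ 2 by rewrite addr_ge0// sqr_ge0.
    rewrite lee_fin !normrM (ger0_norm D10) normr_id ler_pM//.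
    have := sqr_ge0 (`|D t x| - 1); rewrite sqrrB real_normK ?num_real//.
    by have := normr_ge0 (D t x); lra.
  - apply: integrableZl => //.
    rewrite (_ : (fun x => _) = (cst 1 \+ (EFin \o (fun x => D t x ^+ 2)%R))%E);
      last by apply/funext => x /=; rewrite EFinD.
    by apply: integrableD => //; exact: finite_measure_integrable_cst.
pose B x := (S eps s k x ^+ 2 + D t x ^+ 2) + 2 * (Z x * D t x).
have iB : P.-integrable setT (EFin \o B).
  rewrite (_ : EFin \o B = ((EFin \o (fun x => S eps s k x ^+ 2)%R) \+
    (EFin \o (fun x => D t x ^+ 2)%R)) \+
    (fun x => 2%:E * (EFin \o (fun x => Z x * D t x)%R) x))%E; last first.
    by apply/funext => x.
  by apply: integrableD => //; [exact: integrableD|exact: integrableZl].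
have SB x : S eps s k.+1 x ^+ 2 <= B x.
  rewrite /S/= -/(S eps s k x) /B /Z; case: ifPn => _.
    by rewrite le_eqVlt; apply/orP; left; apply/eqP; ring.
  by rewrite addr0 mul0r mulr0 addr0 lerDl sqr_ge0.
have mS1 : measurable_fun setT (EFin \o (fun x => S eps s k.+1 x ^+ 2)).
  apply/measurable_EFinP/measurable_funX.
  exact: (measurable_wrt_measurable (FT _) (@measurable_frozen_sum eps s k.+1)).
have B0 x : 0 <= B x by rewrite (le_trans _ (SB x))// sqr_ge0.
split.
  apply: le_integrable iB => // x _ /=.
  by rewrite lee_fin !ger0_norm// sqr_ge0.
have intB : (\int[P]_x (B x)%:E <= (\sum_(s <= r < s + k.+1) c r)%:E)%E.
  rewrite (_ : (fun x => _) = ((EFin \o (fun x => S eps s k x ^+ 2)%R) \+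
    (EFin \o (fun x => D t x ^+ 2)%R)) \+
    (fun x => 2%:E * (EFin \o (fun x => Z x * D t x)%R) x))%E; last first.
    by apply/funext => x.
  rewrite integralD//; [|exact: integrableD|exact: integrableZl].
  rewrite integralD// integralZl// (Dorth mZ Zle iZD) mule0 adde0.
  by rewrite addnS big_nat_recr ?leq_addr//= EFinD leeD.
apply: le_trans intB; apply: le_integral => //; last first.
  by move=> x _; rewrite lee_fin.
by apply: le_integrable iB => // x _ /=; rewrite lee_fin !ger0_norm// sqr_ge0.
Qed.

Lemma frozen_sum_prob eps s k : 0 < eps ->
  (P [set x | (eps <= `|S eps s k x|)%R] <=
    ((\sum_(s <= r < s + k) c r) / eps ^+ 2)%R%:E)%E.
Proof.
move=> e0; have [iS SC] := frozen_sum_moment eps s k.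
have mE := measurable_frozen_level eps s k.
have m2 : measurable_fun setT (EFin \o (fun x => S eps s k x ^+ 2)).
  exact: measurable_int iS.
rewrite EFinM lee_pdivlMr ?exprn_gt0// muleC -integral_cst//.
apply: le_trans SC.
apply: (@le_trans _ _ (\int[P]_(x in [set x | (eps <= `|S eps s k x|)%R])
    (S eps s k x ^+ 2)%:E)%E).
  apply: ge0_le_integral => //.
  - by move=> x _; rewrite lee_fin sqr_ge0.
  - by apply: measurable_funTS.
  - move=> x /= ex; rewrite lee_fin -(real_normK (num_real (S eps s k x))).
    by rewrite ler_pXn2r// ?nnegrE ?normr_ge0 ?ltW.
by apply: ge0_subset_integral => // x _; rewrite lee_fin sqr_ge0.
Qed.

Lemma increment_bound_ge0 t : 0 <= c t.
Proof.
rewrite -lee_fin (le_trans _ (D2 t))// integral_ge0// => x _.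
by rewrite lee_fin sqr_ge0.
Qed.

(** Kolmogorov's maximal inequality on an infinite window, with the exceptional
event enlarged to a measurable one. *)
Lemma partial_sums_prob eps s : 0 < eps -> exists U : set T,
  [/\ measurable U,
      forall x t, (s <= t)%N -> eps <= `|\sum_(s <= r < t) D r x| -> U x
    & (P U <= (eps ^- 2)%:E * \sum_(s <= r <oo) (c r)%:E)%E].
Proof.
move=> e0; pose E k := [set x | eps <= `|S eps s k x|].
have mE k : measurable (E k) := measurable_frozen_level eps s k.
have mU : measurable (\bigcup_k E k) by exact: bigcupT_measurable.
exists (\bigcup_k E k); split => //.
  by move=> x t st ex; exists (t - s)%N => //; exact: frozen_sumP ex.
have PE : P (E k) @[k --> \oo] --> P (\bigcup_k E k).
  apply: nondecreasing_cvg_mu => // k l kl; apply/subsetPset => x.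
  exact: frozen_sum_mono.
rewrite -(cvg_lim _ PE)//; apply: lime_le.
  by apply/cvg_ex; exists (P (\bigcup_k E k)).
apply: nearW => k; apply: (le_trans (frozen_sum_prob s k e0)).
rewrite EFinM muleC lee_wpmul2l ?lee_fin ?invr_ge0 ?exprn_ge0 ?(ltW e0)//.
rewrite -sumEFin; apply: nneseries_lim_ge => r _ _.
by rewrite lee_fin increment_bound_ge0.
Qed.

(** The bound of the maximal inequality vanishes as the window recedes, so almost
surely some window has partial sums below any given level; every later window is
a difference of two such sums. *)
Lemma partial_sums_tails_cvg0 : (\sum_(0 <= r <oo) (c r)%:E < +oo)%E ->
  {ae P, forall x, forall eps, 0 < eps -> \forall s \near \oo,
     forall t, (s <= t)%N -> `|\sum_(s <= r < t) D r x| <= eps}.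
Proof.
move=> coo.
have c0 r : (0 <= (c r)%:E)%E by rewrite lee_fin increment_bound_ge0.
have tail0 := nneseries_tail_cvg coo (fun r _ => c0 r).
have aen j : {ae P, forall x, exists s, forall t, (s <= t)%N ->
    `|\sum_(s <= r < t) D r x| < j.+1%:R^-1}.
  have j0 : 0 < (j.+1%:R^-1 : R) by rewrite invr_gt0 ltr0n.
  have /choice[U HU] := fun s => partial_sums_prob s j0.
  exists (\bigcap_s U s); split.
  - by apply: bigcapT_measurable => s; have [] := HU s.
  - apply/eqP; rewrite eq_le measure_ge0 andbT.
    have : ((j.+1%:R^-1 ^- 2)%:E * \sum_(s <= r <oo) (c r)%:E)%E @[s --> \oo]
        --> ((j.+1%:R^-1 ^- 2)%:E * 0 : \bar R)%E.
      exact: cvgeZl.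
    rewrite mule0 => cvg0; rewrite -(cvg_lim _ cvg0)//; apply: lime_ge.
      by apply/cvg_ex; exists 0%E.
    apply: nearW => s; have [mU _ PU] := HU s; apply: le_trans PU.
    apply: le_measure; rewrite ?inE//.
      by apply: bigcapT_measurable => s'; have [] := HU s'.
    exact: bigcap_inf.
  - move=> x /= nx s _; have [_ + _] := HU s; move/(_ x).
    apply: contrapT => /not_implyP[h nU]; apply: nx; exists s => t st.
    by rewrite ltNge; apply/negP => /(h _ st).
have := ae_foralln aen.
apply: filterS => x xn eps e0.
have [j je] : exists j, j.+1%:R^-1 < eps / 2.
  have e2 : 0 < eps / 2 by lra.
  by have [j _ /(_ j (leqnn j))] := near_infty_natSinv_lt (PosNum e2); exists j.
have [s0 hs0] := xn j.
exists s0 => // s /= s0s t st.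
have s0t := leq_trans s0s st.
rewrite (_ : \sum_(s <= r < t) D r x =
    \sum_(s0 <= r < t) D r x - \sum_(s0 <= r < s) D r x); last first.
  by rewrite [X in _ = X - _](@big_cat_nat _ _ _ s)//= addrAC subrr add0r.
apply: (le_trans (ler_normB _ _)).
by have := lt_trans (hs0 _ s0t) je; have := lt_trans (hs0 _ s0s) je; lra.
Qed.

End orthogonal_increments.

(** * Step sizes and bounded sequences *)

Lemma nneseries_partial_unbounded (R : realType) (g : nat -> R) (s : nat) (B : R) :
  (forall t, 0 <= g t) -> (\sum_(0 <= t <oo) (g t)%:E = +oo)%E ->
  exists2 t, (s <= t)%N & B < \sum_(s <= r < t) g r.
Proof.
move=> g0 gy; apply: contrapT => noex.
have le t : (s <= t)%N -> \sum_(s <= r < t) g r <= B.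
  by move=> st; rewrite leNgt; apply/negP => h; apply: noex; exists t.
suff : (\sum_(0 <= t <oo) (g t)%:E <= (\sum_(0 <= r < s) g r + B)%:E)%E.
  by rewrite gy leye_eq.
apply: lime_le; first by apply: is_cvg_nneseries => t _ _; rewrite lee_fin.
near=> t; have st : (s <= t)%N by near: t; exact: nbhs_infty_ge.
by rewrite sumEFin lee_fin (@big_cat_nat _ _ _ s)//= lerD2l le.
Unshelve. all: by end_near. Qed.

Lemma sqr_summable_le1 (R : realType) (g : nat -> R) :
  (\sum_(0 <= t <oo) (g t ^+ 2)%:E < +oo)%E -> \forall t \near \oo, g t <= 1.
Proof.
move=> g2; have g2_ge0 t : (0 <= (g t ^+ 2)%:E)%E by rewrite lee_fin sqr_ge0.
have /fine_cvgP[fin /cvgrPdist_lt/(_ _ ltr01)] :=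
  nneseries_tail_cvg g2 (fun t _ => g2_ge0 t).
move: fin; apply: filterS2 => t fin; rewrite /= sub0r normrN => /(le_lt_trans (ler_norm _)).
rewrite -lte_fin fineK// => h.
have : ((g t ^+ 2)%:E < 1%:E)%E.
  apply: le_lt_trans h.
  have := @nneseries_lim_ge R (fun k => (g k ^+ 2)%:E) xpredT t t.+1
    (fun k _ _ => g2_ge0 k).
  by rewrite big_nat1.
rewrite lte_fin => gt1; rewrite leNgt; apply/negP => gt; move: gt1.
by rewrite ltNge exprn_ege1// ltW.
Qed.

Lemma bounded_of_ereal_sup (R : realType) (f : nat -> R) :
  (ereal_sup (range (fun t => (f t)%:E)) < +oo)%E -> exists K, forall t, f t <= K.
Proof.
have ub t : ((f t)%:E <= ereal_sup (range (fun t => (f t)%:E)))%E.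
  by apply: ereal_sup_ubound; exists t.
case: ereal_sup ub => [K| |] ub _ //.
  by exists K => t; rewrite -lee_fin.
by have := ub 0%N.
Qed.

(** * Running maxima *)

(** The running maximum, started at [1] so that it can be divided by. *)
Fixpoint runmax (R : realType) (X : nat -> R) (t : nat) : R :=
  Num.max (if t is t'.+1 then runmax X t' else 1) (X t).

Section runmax.
Context (R : realType) (X : nat -> R).

Lemma runmax_ge t : X t <= runmax X t.
Proof. by case: t => [|t] /=; rewrite le_max lexx orbT. Qed.

Lemma runmax_mono t : runmax X t <= runmax X t.+1.
Proof. by rewrite /= le_max lexx. Qed.

Lemma runmax_ge1 t : 1 <= runmax X t.
Proof.
elim: t => [|t ih]; first by rewrite /= le_max lexx.
exact: le_trans ih (runmax_mono t).
Qed.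

Lemma runmaxS_le t K : runmax X t <= K -> X t.+1 <= K -> runmax X t.+1 <= K.
Proof. by move=> mK XK; rewrite /= ge_max mK. Qed.

Lemma runmax_le K t : 1 <= K -> (forall r, X r <= K) -> runmax X t <= K.
Proof.
by move=> K1 XK; elim: t => [|t ih]; rewrite /= ge_max XK ?K1 ?ih.
Qed.

End runmax.

Lemma adapted_runmax (T : pointedType) (F : nat -> set (set T)) (R : realType)
    (X : nat -> T -> R) :
  (forall s t, (s <= t)%N -> F s `<=` F t) -> adapted F X ->
  adapted F (fun t x => runmax (X ^~ x) t).
Proof.
move=> Fmono mX; elim=> [|t ih].
  by apply: measurable_maxr; [exact: measurable_cst|exact: mX].
apply: measurable_maxr; last exact: mX.
exact: measurable_wrt_sub (Fmono _ _ (leqnSn t)) ih.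
Qed.

Lemma measurable_inv_ge1 (d : measure_display) (T : measurableType d)
    (R : realType) (f : T -> R) :
  (forall x, 1 <= f x) -> measurable_fun setT f ->
  measurable_fun setT (fun x => (f x)^-1).
Proof.
move=> f1 mf.
rewrite (_ : (fun x => _) = (fun y : R => (Num.max 1 y)^-1) \o f); last first.
  by apply/funext => x /=; rewrite max_r.
apply: measurableT_comp mf; apply: continuous_measurable_fun => y.
apply: cvgV; first by rewrite gt_eqF// lt_max ltr01.
by apply: continuous_max; [exact: cvg_cst|exact: cvg_id].
Qed.

Lemma measurable_bigmaxr (d : measure_display) (T : measurableType d)
    (R : realType) (I : Type) (r : seq I) (f : I -> T -> R) :
  (forall i, measurable_fun setT (f i)) ->
  measurable_fun setT (fun x => \big[Num.max/0]_(i <- r) f i x).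
Proof.
move=> mf; elim: r => [|i r ih].
  by under eq_fun do rewrite big_nil; exact: measurable_cst.
by under eq_fun do rewrite big_cons; exact: measurable_maxr.
Qed.

(** * Weighted maximum norms *)

Section weighted_max_norm.
Context (R : realType) (n : nat) (theta : 'rV[R]_n).
Context (theta_gt0 : forall i, 0 < theta 0 i).

Lemma wmax_norm_ge (v : 'rV[R]_n) i : `|v 0 i / theta 0 i| <= wmax_norm theta v.
Proof.
rewrite normrM normfV (gtr0_norm (theta_gt0 i)).
exact: (le_bigmax _ (fun i => `|v 0 i| / theta 0 i)).
Qed.

Lemma wmax_norm_ge0 (v : 'rV[R]_n) : 0 <= wmax_norm theta v.
Proof. exact: bigmax_ge_id. Qed.

Lemma wmax_norm_le (v : 'rV[R]_n) K : 0 <= K ->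
  (forall i, `|v 0 i / theta 0 i| <= K) -> wmax_norm theta v <= K.
Proof.
move=> K0 vK; apply: bigmax_le => // i _; have := vK i.
by rewrite normrM normfV (gtr0_norm (theta_gt0 i)).
Qed.

(** The easy half of the equivalence of norms: expand in the canonical basis. *)
Lemma norm_wmax_le (N : 'rV[R]_n -> R) : is_norm N ->
  exists2 C, 0 <= C & forall v, 0 <= N v <= C * wmax_norm theta v.
Proof.
move=> [ND NZ _].
have N0 : N 0 = 0 by rewrite -[0 in LHS](scale0r 0) NZ normr0 mul0r.
have Nge0 v : 0 <= N v.
  have := ND v (- v); rewrite subrr N0 -scaleN1r NZ normrN1 mul1r.
  by rewrite -mulr2n pmulrn_lge0.
exists (\sum_i theta 0 i * N (delta_mx 0 i)) => [|v].
  by apply: sumr_ge0 => i _; rewrite mulr_ge0// ltW.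
rewrite Nge0/= {1}(row_sum_delta v).
apply: (@le_trans _ _ (\sum_i N (v 0 i *: delta_mx 0 i))).
  elim/big_ind2: _ => [|a b a' b' ab ab'|//]; first by rewrite N0.
  by apply: le_trans (ND _ _) _; exact: lerD.
rewrite mulr_suml; apply: ler_sum => i _; rewrite NZ mulrAC ler_wpM2r//.
have := wmax_norm_ge v i; rewrite normrM normfV (gtr0_norm (theta_gt0 i)).
by rewrite ler_pdivrMr// mulrC.
Qed.

End weighted_max_norm.

Lemma adapted_wmax_norm (T : pointedType) (F : nat -> set (set T))
    (R : realType) (n : nat) (theta c : 'rV[R]_n) (X : nat -> T -> 'rV[R]_n) :
  adapted_vec F X -> adapted F (fun t x => wmax_norm theta (X t x - c)).
Proof.
move=> mX t; apply: measurable_bigmaxr => i.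
apply: measurable_funM; last exact: measurable_cst.
apply: measurableT_comp => //.
rewrite [X in measurable_fun _ X](_ : _ = (fun x => X t x 0 i - c 0 i)); last first.
  by apply/funext => x; rewrite !mxE.
by apply: measurable_funB; [exact: mX|exact: measurable_cst].
Qed.

Lemma cvg_rowP (R : realType) (n : nat) (theta : 'rV[R]_n) (X : nat -> 'rV[R]_n)
    (l : 'rV[R]_n) :
  (forall i, 0 < theta 0 i) ->
  (forall e, 0 < e -> \forall t \near \oo, forall i,
     `|(X t 0 i - l 0 i) / theta 0 i| <= e) ->
  X t @[t --> \oo] --> l.
Proof.
move=> th0 Xl; apply/cvg_ballP => e e0.
pose S := 1 + \sum_i theta 0 i.
have thS i : theta 0 i < S.
  rewrite /S (bigD1 i)//= addrCA ltrDl ltr_pwDl//.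
  by apply: sumr_ge0 => j _; exact: ltW.
have S0 : 0 < S by rewrite /S ltr_pwDl// sumr_ge0// => i _; exact: ltW.
apply: filterS (Xl _ (divr_gt0 e0 S0)) => t Xt; split => // j i.
rewrite ord1 /ball/= distrC; have := Xt i.
rewrite normrM normfV (gtr0_norm (th0 i)) ler_pdivrMr//.
move=> /le_lt_trans; apply.
by rewrite -mulrA gtr_pMr// mulrC ltr_pdivrMr// mul1r.
Qed.

(** * The normalised noise *)

(** Dividing the noise by a past variable [q] that dominates its conditional
standard deviation up to a constant makes its second moments uniformly bounded. *)
Lemma normalized_noise_tails (d : measure_display) (T : measurableType d)
    (R : realType) (P : probability T R) (F : nat -> set (set T))
    (g : nat -> R) (w q v : nat -> T -> R) (K : R) :
  is_filtration F -> adapted (fun t => F t.+1) w -> adapted F q ->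
  (forall t x, 1 <= q t x) ->
  (\sum_(0 <= t <oo) (g t ^+ 2)%:E < +oo)%E ->
  (forall t, is_cond_exp P (F t) (EFin \o w t) (fun=> 0%E)) ->
  (forall t, exists V : T -> \bar R,
    is_cond_exp P (F t) (fun x => (w t x ^+ 2)%:E) V /\
    {ae P, forall x, (V x <= (v t x)%:E)%E}) ->
  0 <= K -> (forall t x, v t x <= K * q t x ^+ 2) ->
  {ae P, forall x, forall eps, 0 < eps -> \forall s \near \oo,
     forall t, (s <= t)%N -> `|\sum_(s <= r < t) g r * w r x / q r x| <= eps}.
Proof.
move=> FF mw mq q1 g2 w0 wV K0 vK; have [Fsig FT Fmono] := FF.
have q_gt0 t x : 0 < q t x := lt_le_trans ltr01 (q1 t x).
have mqV t : measurable_wrt (F t) (fun x => (q t x)^-1).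
  exact: (@measurable_inv_ge1 _ (g_sigma_algebraType (F t)) _ _ (q1 t) (mq t)).
apply: (@partial_sums_tails_cvg0 _ _ _ P F (fun t x => g t * w t x / q t x)
  (fun t => K * g t ^+ 2) FF).
- move=> t; apply: measurable_funM.
    by apply: measurable_funM; [exact: measurable_cst|exact: mw].
  exact: measurable_wrt_sub (Fmono _ _ (leqnSn t)) (mqV t).
- move=> t; have [V [hV Vv]] := wV t.
  rewrite (_ : (fun x => _) =
      (fun x => ((g t / q t x) ^+ 2 * w t x ^+ 2)%:E)); last first.
    by apply/funext => x; congr EFin; rewrite mulrAC exprMn.
  apply: (cond_exp_weighted_le (Fsig t) (FT t) _ hV Vv).
  + by move=> x; exact: sqr_ge0.
  + apply: measurable_funX; apply: measurable_funM; last exact: mqV.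
    exact: measurable_cst.
  + by rewrite mulr_ge0// sqr_ge0.
  + by move=> x; exact: sqr_ge0.
  + move=> x; apply: (@le_trans _ _ ((g t / q t x) ^+ 2 * (K * q t x ^+ 2))).
      by rewrite ler_wpM2l ?sqr_ge0.
    rewrite le_eqVlt; apply/orP; left; apply/eqP; field.
    by rewrite gt_eqF.
- move=> t Z M mZ ZM iZD.
  have E : (fun x => Z x * (g t * w t x / q t x)) =
      (fun x => (Z x * (g t / q t x)) * w t x).
    by apply/funext => x; ring.
  rewrite (_ : (fun x => _) = (fun x => ((Z x * (g t / q t x)) * w t x)%:E)); last first.
    by apply/funext => x; congr EFin; ring.
  apply: (cond_exp0_orthogonal (Fsig t) (FT t) (w0 t)); last by rewrite -E.
  apply: measurable_funM => //; apply: measurable_funM; last exact: mqV.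
  exact: measurable_cst.
- under eq_eseriesr do rewrite EFinM.
  rewrite nneseriesZl; last by move=> t _; rewrite lee_fin sqr_ge0.
  rewrite ltey_eq; apply/orP; left.
  rewrite fin_numM// ge0_fin_numE//; apply: nneseries_ge0 => t _ _.
  by rewrite lee_fin sqr_ge0.
Qed.

(** * Boundedness and convergence *)

Unset Implicit Arguments.

Theorem proposition23 (R : realType) (d : measure_display)
  (T : measurableType d) (P : probability T R) (n : nat)
  (norm : 'rV[R]_n -> R) (F : nat -> set (set T))
  (gamma : nat -> 'I_n -> R)
  (H : nat -> T -> 'rV[R]_n -> 'rV[R]_n)
  (J w u : nat -> T -> 'rV[R]_n)
  (theta Jstar : 'rV[R]_n) (beta D : R)
  (A B vartheta : nat -> T -> R)
  (norm_is_norm : is_norm norm)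
  (F_filtration : is_filtration F)
  (J_adapted : adapted_vec F J)
  (w_measurable : adapted_vec (fun t => F t.+1) w)
  (J_rec : forall t x i, J t.+1 x 0 i =
     (1 - gamma t i) * J t x 0 i
     + gamma t i * (H t x (J t x) 0 i + w t x 0 i + u t x 0 i))
  (gamma_ge0 : forall t i, 0 <= gamma t i)
  (gamma_sum : forall i, (\sum_(0 <= t <oo) (gamma t i)%:E = +oo)%E)
  (gamma_sqr_sum : forall i, (\sum_(0 <= t <oo) (gamma t i ^+ 2)%:E < +oo)%E)
  (theta_gt0 : forall i, 0 < theta 0 i)
  (beta_ge0 : 0 <= beta) (beta_lt1 : beta < 1) (D_ge0 : 0 <= D)
  (H_contraction : {ae P, forall x, forall t (v : 'rV[R]_n),
     wmax_norm theta (H t x v - Jstar)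
       <= beta * wmax_norm theta (v - Jstar) + D})
  (HJ_adapted : adapted_vec F (fun t x => H t x (J t x)))
  (A_adapted : adapted F A) (B_adapted : adapted F B)
  (A_bounded : as_bounded P A) (B_bounded : as_bounded P B)
  (w_mean : forall t i,
     is_cond_exp P (F t) (fun x => (w t x 0 i)%:E) (fun=> 0%E))
  (w_variance : forall t i, exists V : T -> \bar R,
     is_cond_exp P (F t) (fun x => (w t x 0 i ^+ 2)%:E) V /\
     {ae P, forall x, (V x <= (A t x + B t x * norm (J t x) ^+ 2)%:E)%E})
  (vartheta_adapted : adapted F vartheta)
  (vartheta_cvg0 : {ae P, forall x, vartheta t x @[t --> \oo] --> (0 : R)})
  (u_adapted : adapted_vec F u)
  (u_bound : {ae P, forall x, forall t i,
     `|u t x 0 i| <= vartheta t x * (norm (J t x) + 1)}) :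
  as_bounded P (fun t x => norm (J t x)) /\
  (D = 0 -> {ae P, forall x, J t x @[t --> \oo] --> Jstar}).
Proof.
have [Fsig FT Fmono] := F_filtration.
have [C0 C0_ge0 NC0] := norm_wmax_le theta_gt0 norm_is_norm.
have norm_ge0 v : 0 <= norm v by have /andP[] := NC0 v.
(* The normaliser [q]: past-measurable, at least [1], and at most a trajectorywise
   constant times the running maximum [m] of the trajectory. *)
pose m t x := runmax (fun r => wmax_norm theta (J r x - Jstar)) t.
pose a t x := runmax (fun r => Num.max (A r x) (B r x)) t.
pose q t x := m t x * a t x.
have m1 t x : 1 <= m t x := runmax_ge1 _ t.
have a1 t x : 1 <= a t x := runmax_ge1 _ t.
have m0 t x : 0 <= m t x := le_trans ler01 (m1 t x).
have a0 t x : 0 <= a t x := le_trans ler01 (a1 t x).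
have q1 t x : 1 <= q t x by rewrite mulr_ege1.
pose C := C0 + norm Jstar.
have C_ge0 : 0 <= C by rewrite addr_ge0.
have normJ t x : norm (J t x) <= C * m t x.
  have [ND _ _] := norm_is_norm.
  rewrite -{1}(subrK Jstar (J t x)); apply: (le_trans (ND _ _)).
  rewrite mulrDl lerD//; last by rewrite ler_peMr.
  have /andP[_ h] := NC0 (J t x - Jstar); apply: (le_trans h).
  by rewrite ler_wpM2l// (runmax_ge (fun r => wmax_norm theta (J r x - Jstar))).
have mm : adapted F m by apply: adapted_runmax => //; exact: adapted_wmax_norm.
have ma : adapted F a.
  apply: adapted_runmax => // t.
  by apply: measurable_maxr; [exact: A_adapted|exact: B_adapted].
have mq : adapted F q by move=> t; apply: measurable_funM; [exact: mm|exact: ma].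
have A_le t x : A t x <= a t x.
  by apply: le_trans (runmax_ge _ t); rewrite le_max lexx.
have B_le t x : B t x <= a t x.
  by apply: le_trans (runmax_ge _ t); rewrite le_max lexx orbT.
have vK t x : A t x + B t x * norm (J t x) ^+ 2 <= (1 + C ^+ 2) * q t x ^+ 2.
  have q2 : q t x ^+ 2 = a t x ^+ 2 * m t x ^+ 2 by rewrite /q exprMn mulrC.
  have a2 : a t x <= a t x ^+ 2 by rewrite expr2 ler_peMr.
  have m2 : 1 <= m t x ^+ 2 by rewrite exprn_ege1.
  have n2 : norm (J t x) ^+ 2 <= C ^+ 2 * m t x ^+ 2.
    by rewrite -exprMn ler_pXn2r// nnegrE ?mulr_ge0.
  rewrite mulrDl mul1r lerD//.
    apply: (le_trans (A_le t x)); rewrite q2; apply: (le_trans a2).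
    by rewrite ler_peMr// sqr_ge0.
  apply: (@le_trans _ _ (a t x * (C ^+ 2 * m t x ^+ 2))).
    apply: (@le_trans _ _ (a t x * norm (J t x) ^+ 2)).
      by rewrite ler_wpM2r// sqr_ge0.
    by rewrite ler_wpM2l.
  by rewrite q2 mulrCA ler_wpM2l ?sqr_ge0// ler_wpM2r// sqr_ge0.
have noise i : {ae P, forall x, forall eps, 0 < eps -> \forall s \near \oo,
    forall t, (s <= t)%N ->
    `|\sum_(s <= r < t) gamma r i / theta 0 i * w r x 0 i / q r x| <= eps}.
  apply: (@normalized_noise_tails _ _ _ P F (fun t => gamma t i / theta 0 i)
    (fun t x => w t x 0 i) q (fun t x => A t x + B t x * norm (J t x) ^+ 2)
    (1 + C ^+ 2)); last 3 first.
  - by move=> r; exact: w_variance.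
  - by rewrite addr_ge0// sqr_ge0.
  - exact: vK.
  - by [].
  - by move=> r; exact: w_measurable.
  - exact: mq.
  - exact: q1.
  - under eq_eseriesr do rewrite exprMn mulrC EFinM.
    rewrite nneseriesZl; last by move=> *; rewrite lee_fin sqr_ge0.
    rewrite ltey_eq; apply/orP; left.
    rewrite fin_numM// ge0_fin_numE//; apply: nneseries_ge0 => r _ _.
    by rewrite lee_fin sqr_ge0.
  - by move=> r; exact: w_mean.
have noise_all : {ae P, forall x, forall i eps, 0 < eps -> \forall s \near \oo,
    forall t, (s <= t)%N ->
    `|\sum_(s <= r < t) gamma r i / theta 0 i * w r x 0 i / q r x| <= eps}.
  exact: filter_forall.
pose E := (C + 1) * \sum_i (theta 0 i)^-1.
have path : {ae P, forall x, exists2 a_, 0 < a_ & noisy_relaxation beta D a_ gamma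
    (fun t i => (J t x 0 i - Jstar 0 i) / theta 0 i)
    (fun t i => (H t x (J t x) 0 i - Jstar 0 i) / theta 0 i)
    (fun t i => u t x 0 i / theta 0 i)
    (fun t i => gamma t i / theta 0 i * w t x 0 i / q t x)
    (m ^~ x) (q ^~ x) (fun t => `|vartheta t x| * E)}.
  have HU : {ae P, forall x, (forall t v,
      wmax_norm theta (H t x v - Jstar) <= beta * wmax_norm theta (v - Jstar) + D)
      /\ forall t i, `|u t x 0 i| <= vartheta t x * (norm (J t x) + 1)}.
    by move: H_contraction u_bound; apply: filterS2 => x; split.
  have AB : {ae P, forall x, exists K, forall t, a t x <= K}.
    move: A_bounded B_bounded; apply: filterS2 => x.
    move=> /bounded_of_ereal_sup[KA hA] /bounded_of_ereal_sup[KB hB].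
    exists (Num.max 1 (Num.max KA KB)) => t; apply: runmax_le => [|r].
      by rewrite le_max lexx.
    by rewrite ge_max !le_max hA hB !orbT.
  have TN : {ae P, forall x, (vartheta t x @[t --> \oo] --> (0 : R)) /\
      forall i eps, 0 < eps -> \forall s \near \oo, forall t, (s <= t)%N ->
      `|\sum_(s <= r < t) gamma r i / theta 0 i * w r x 0 i / q r x| <= eps}.
    by move: vartheta_cvg0 noise_all; apply: filterS2 => x; split.
  move: HU AB TN; apply: filterS3 => x [Hx ux] [K aK] [thx nx].
  have K0 : 0 < K := lt_le_trans ltr01 (le_trans (a1 0%N x) (aK 0%N)).
  exists K => //; split => /=.
  - move=> t i; rewrite J_rec; field.
    by rewrite !gt_eqF// (lt_le_trans ltr01 (q1 t x)).
  - by move=> t i; exact: gamma_ge0.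
  - by apply: filter_forall => i; apply: sqr_summable_le1.
  - move=> t i k yk.
    have k0 : 0 <= k := le_trans (normr_ge0 _) (yk i).
    have h : wmax_norm theta (J t x - Jstar) <= k.
      by apply: wmax_norm_le => // j; rewrite !mxE.
    have := wmax_norm_ge theta_gt0 (H t x (J t x) - Jstar) i.
    rewrite !mxE => /le_trans; apply; apply: (le_trans (Hx _ _)).
    by rewrite lerD2r ler_wpM2l.
  - move=> t i; rewrite normrM normfV (gtr0_norm (theta_gt0 i)).
    have h1 : norm (J t x) + 1 <= (C + 1) * m t x.
      by rewrite mulrDl mul1r lerD.
    have h2 : `|u t x 0 i| <= `|vartheta t x| * ((C + 1) * m t x).
      apply: (le_trans (ux t i)).
      apply: (@le_trans _ _ (`|vartheta t x| * (norm (J t x) + 1))).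
        by rewrite ler_wpM2r ?ler_norm// addr_ge0.
      by rewrite ler_wpM2l.
    have h3 : (theta 0 i)^-1 <= \sum_j (theta 0 j)^-1.
      rewrite (bigD1 i)//= lerDl; apply: sumr_ge0 => j _.
      by rewrite invr_ge0 ltW.
    rewrite [leRHS](_ : _ = `|vartheta t x| * ((C + 1) * m t x) *
      \sum_j (theta 0 j)^-1); last by rewrite /E; ring.
    by rewrite ler_pM// invr_ge0 ltW.
  - rewrite -[X in _ --> X](mul0r E); apply: cvgMl.
    by rewrite -[X in _ --> X](normr0 R); exact: cvg_norm.
  - move=> eps e0.
    have : \forall s \near \oo, forall i t, (s <= t)%N ->
        `|\sum_(s <= r < t) gamma r i / theta 0 i * w r x 0 i / q r x| <= eps.
      by apply: filter_forall => i; exact: nx.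
    by apply: filterS => s h t i; exact: h.
  - by move=> t; exact: le_trans ler01 (q1 t x).
  - by move=> t; rewrite ler_pM// runmax_mono.
  - by move=> t; rewrite /q mulrC ler_wpM2r.
  - by move=> t.
  - by move=> t; exact: runmax_mono.
  - move=> t i.
    have := wmax_norm_ge theta_gt0 (J t x - Jstar) i; rewrite !mxE => /le_trans; apply.
    exact: (runmax_ge (fun r => wmax_norm theta (J r x - Jstar))).
  - move=> t k mk yk; apply: runmaxS_le => //; apply: wmax_norm_le.
    + by [].
    + exact: le_trans (m0 t x) mk.
    + by move=> i; rewrite !mxE.
split.
  move: path; apply: filterS => x [a_ a_0 /relaxation_bounded].
  move=> /(_ beta_ge0 beta_lt1 D_ge0 a_0)[M mM].
  apply: (@le_lt_trans _ _ (C * M)%:E); last by rewrite ltry.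
  apply: ge_ereal_sup => _ [t _ <-]; rewrite lee_fin.
  by apply: (le_trans (normJ t x)); rewrite ler_wpM2l.
move=> D0; move: path; rewrite D0; apply: filterS => x [a_ a_0 path].
apply: (cvg_rowP theta_gt0).
apply: (relaxation_cvg0 path beta_ge0 beta_lt1 a_0) => i s b.
by apply: nneseries_partial_unbounded.
Qed.
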